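(* Let $f(x)\in\mathbb{Z}[x]$ be a univariate polynomial of degree $d$ and $p$ a prime. Let $k>d(\Delta+1)$ and let $\bar{\alpha}\in\mathbb{Z}_p$ be a root of $f(x)\bmod p^k$. There exists a unique $\mathbb{Z}_p$-root $\alpha_i$ of $f$ ($i\in[n]$) such that $v_p(\bar{\alpha}-\alpha_i)>\Delta+1$, and thus $v_p(\bar{\alpha}-\alpha_i)>v_p(\alpha_i-\alpha_j)$ for all $j\ne i$, $j\in[n]$.
   Context: $\mathbb{Z}_p$ is the ring of $p$-adic integers, $v_p$ the $p$-adic valuation (with $v_p(0)=\infty$), and $[n]=\{1,\ldots,n\}$. The polynomial $f$ is viewed in $\mathbb{Z}_p[x]$, with factorization into coprime irreducible factors over $\mathbb{Z}_p$ (up to a unit of $\mathbb{Z}_p$) $f(x)=\prod_{i\in[n]}(x-\alpha_i)^{e_i}\cdot\prod_{j=1}^m g_j(x)^{t_j}$, where $\alpha_1,\dots,\alpha_n$ are the distinct $\mathbb{Z}_p$-roots of $f$, $e_i$ is the multiplicity of $\alpha_i$, and each $g_j\in\mathbb{Z}_p[x]$ is irreducible over $\mathbb{Z}_p$, has no $\mathbb{Z}_p$-root and has multiplicity $t_j$ in $f$. The radical is $\mathrm{rad}(f):=\prod_{i=1}^n(x-\alpha_i)\cdot\prod_{j=1}^m g_j(x)$. The discriminant of a polynomial $h$ of degree $m$ over a field, with leading coefficient $h_m$ and roots $r_1,\dots,r_m$ in an algebraic closure, is $D(h):=h_m^{2m-1}\prod_{1\le i<j\le m}(r_i-r_j)^2$,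 and the discriminant of a linear polynomial is defined to be $1$. $\Delta:=v_p(D(\mathrm{rad}(f)))$.
   Formalization: The irreducible factors g_j are taken to be nonconstant, so f is not divisible by p; if the constant p is allowed as a factor the claim fails, e.g. f = p^100 x, Δ = 0, d = 1, k = 2, ᾱ = 1. *)

(* Defs.v *)
From HB Require Import structures.
From mathcomp Require Import all_boot all_order all_algebra.
From mathcomp Require Import perm fieldext mpoly.
From mathcomp Require Import boolp constructive_ereal zify ring.

Set Implicit Arguments.
Unset Strict Implicit.
Unset Printing Implicit Defensive.
Import Order.TTheory GRing.Theory Num.Theory.
Local Open Scope ring_scope.

(* h has degree m, the r_i are its roots listed with multiplicity in an
   extension L of F over which h splits, and
   D = h_m^(2m-1) \prod_(i < j) (r_i - r_j)^2, viewed in F. *)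
Definition is_disc (F : fieldType) (h : {poly F}) (D : F) : Prop :=
  let m := (size h).-1 in
  exists (L : fieldType) (iota : {rmorphism F -> L}) (r : m.-tuple L),
    map_poly iota h
      = iota (lead_coef h) *: \prod_(i < m) ('X - (tnth r i)%:P) /\
    iota D = iota (lead_coef h) ^+ (2 * m - 1)
             * \prod_(i < m) \prod_(j < m | (i < j)%N)
                 (tnth r i - tnth r j) ^+ 2.

(* The discriminant of a linear polynomial is 1 by convention.  Otherwise it is
   chosen by its defining property; discP and disc_uniq show that it exists and
   is unique for h != 0. *)
Definition disc (F : fieldType) (h : {poly F}) : F :=
  if size h == 2 then 1
  else if pselect (exists D, is_disc h D) is left ex then sval (cid ex) else 0.

Lemma vander2_sym (R : comNzRingType) n :
  ((\prod_(i < n) \prod_(j < n | (i < j)%N) ('X_i - 'X_j) ^+ 2)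
     : {mpoly R[n]}) \is symmetric.
Proof.
pose V : 'M[{mpoly R[n]}]_n := Vandermonde n (\row_i 'X_i).
suff -> : \prod_(i < n) \prod_(j < n | (i < j)%N) ('X_i - 'X_j) ^+ 2
    = (\det V) ^+ 2 :> {mpoly R[n]}.
  apply/issymP=> s; rewrite rmorphXn /= -det_map_mx.
  have -> : map_mx (msym s) V = col_perm s V.
    apply/matrixP=> i j; rewrite !mxE rmorphXn /= msymX; congr (_ ^+ _).
    congr 'X_[_]; apply/mnmP=> k; rewrite mnmE !mnm1E.
    by rewrite -(inj_eq (@perm_inj _ s)) permKV.
  by rewrite col_permE det_mulmx exprMn det_perm sqrr_sign mulr1.
rewrite det_Vandermonde -prodrXl; apply: eq_bigr => i _.
rewrite -prodrXl; apply: eq_bigr => j _.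
by rewrite !mxE -[in RHS]opprB sqrrN.
Qed.

Lemma disc_mpoly n : {t : {mpoly int[n]} |
  forall (L : fieldType) (r : n.-tuple L),
    \prod_(i < n) \prod_(j < n | (i < j)%N) (tnth r i - tnth r j) ^+ 2
    = mmap intr (fun k : 'I_n => (-1) ^+ k.+1 *
         (\prod_(i < n) ('X - (tnth r i)%:P))`_(n - k.+1)) t}.
Proof.
have [t [Dt _]] := sym_fundamental (vander2_sym int n).
exists t => L r.
pose ev : {rmorphism {mpoly int[n]} -> L} := mmap intr (tnth r).
have evX i : ev 'X_i = tnth r i by rewrite /ev /= mmapX mmap1U.
transitivity (ev (t \mPo [tuple mesym n int i.+1 | i < n])).
  rewrite Dt rmorph_prod; apply: eq_bigr => i _.
  rewrite rmorph_prod; apply: eq_bigr => j _.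
  by rewrite rmorphXn rmorphB /= !evX.
rewrite comp_mpolyE raddf_sum /=; apply: eq_bigr => m _.
rewrite mmapZ; congr (_ * _); rewrite rmorph_prod; apply: eq_bigr => k _.
rewrite rmorphXn; congr (_ ^+ _); rewrite tnth_mktuple -(big_tuple _ _ r predT (fun x => 'X - x%:P)).
have lt_kn : (k.+1 < n.+1)%N by rewrite ltnS.
rewrite (mroots_coeff r (Ordinal lt_kn)) /= signrMK.
rewrite /mesym !rmorph_sum; apply: eq_bigr => A _.
rewrite /= !rmorph_prod; apply: eq_bigr => i _.
by rewrite evX /= mevalXU.
Qed.

Lemma is_disc_formula (F : fieldType) (h : {poly F}) (L : fieldType)
    (iota : {rmorphism F -> L}) (m := (size h).-1) (r : m.-tuple L) :
  h != 0 ->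
  map_poly iota h
    = iota (lead_coef h) *: \prod_(i < m) ('X - (tnth r i)%:P) ->
  let D := lead_coef h ^+ (2 * m - 1)
     * mmap intr (fun k : 'I_m => (-1) ^+ k.+1 * (h`_(m - k.+1) / lead_coef h))
         (sval (disc_mpoly m)) in
  iota D = iota (lead_coef h) ^+ (2 * m - 1)
             * \prod_(i < m) \prod_(j < m | (i < j)%N)
                 (tnth r i - tnth r j) ^+ 2.
Proof.
move=> nzh Dh /=; rewrite rmorphM rmorphXn; congr (_ * _).
rewrite (svalP (disc_mpoly m)) [LHS]rmorph_sum; apply: eq_bigr => a _.
rewrite rmorphM rmorph_int; congr (_ * _); rewrite rmorph_prod.
apply: eq_bigr => k _; rewrite rmorphXn; congr (_ ^+ _).
rewrite rmorphM rmorph_sign; congr (_ * _).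
rewrite fmorph_div -coef_map Dh coefZ mulrAC divff ?mul1r //.
by rewrite fmorph_eq0 lead_coef_eq0.
Qed.

Lemma splitting_ex (F : fieldType) (h : {poly F}) : h != 0 ->
  exists (L : fieldType) (iota : {rmorphism F -> L}) (r : (size h).-1.-tuple L),
    map_poly iota h
      = iota (lead_coef h) *: \prod_(i < (size h).-1) ('X - (tnth r i)%:P).
Proof.
move=> nzh; suff [L [iota [r Dr]]] : exists (L : fieldType)
    (iota : {rmorphism F -> L}) (r : seq L),
    map_poly iota h = iota (lead_coef h) *: \prod_(x <- r) ('X - x%:P).
  have sz : size r == (size h).-1.
    rewrite -(size_map_poly iota h) Dr size_scale ?size_prod_XsubC //.
    by rewrite fmorph_eq0 lead_coef_eq0.
  exists L, iota, (Tuple sz); rewrite Dr; congr (_ *: _).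
  by rewrite -(big_tuple _ _ (Tuple sz) predT (fun x => 'X - x%:P)).
move: {2}(size h) (leqnn (size h)) => n.
elim: n => [|n IHn] in F h nzh *.
  by rewrite leqn0 size_poly_eq0 (negPf nzh).
have [Ch _|C'h le_hn] := leqP (size h) 1.
  exists F, idfun, [::]; rewrite big_nil alg_polyC map_poly_id //=.
  by rewrite [LHS](size1_polyC Ch) lead_coefE (eqP (_ : (size h).-1 == 0%N)) //; case: (size h) Ch => [|[]].
have [q q_dv_h irr_q] : exists2 q, q %| h & irreducible_poly q.
  move: {2}(size h) (leqnn (size h)) => k {le_hn n IHn}.
  elim: k => [|k IHk] in h nzh C'h *; first by rewrite leqNgt ltnW.
  move=> le_hk; have [irr_h|] := pselect (irreducible_poly h); first by exists h.
  move=> red_h; have [q [C'q q_dv_h neq]] :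
      exists q : {poly F}, [/\ size q != 1, q %| h & ~~ (q %= h)].
    apply: contrapT => nex; apply: red_h; split=> // q C'q q_dv_h.
    by apply: contrapT => /negP neq; apply: nex; exists q.
  have nzq : q != 0 by apply: dvdpN0 q_dv_h nzh.
  have [||u u_dv_q irr_u] := IHk q nzq.
  - by rewrite ltn_neqAle eq_sym C'q size_poly_gt0.
  - rewrite -ltnS (leq_trans _ le_hk) // ltn_neqAle dvdp_leq // andbT.
    by rewrite dvdp_size_eqp.
  by exists u => //; apply: dvdp_trans u_dv_q q_dv_h.
have [K _ [z qz0 _]] := irredp_FAdjoin irr_q.
pose j : {rmorphism F -> K} := in_alg K.
have hz0 : root (map_poly j h) z.
  by move: qz0; rewrite !root_factor_theorem => /dvdp_trans -> //; rewrite dvdp_map.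
have [g Dg] := factor_theorem _ _ hz0.
have nzg : g != 0.
  apply: contraNneq nzh => g0; rewrite -(map_poly_eq0 j).
  by rewrite [map_poly _ _]Dg g0 mul0r.
have lg : lead_coef g = j (lead_coef h).
  by rewrite -lead_coef_map [map_poly _ _]Dg lead_coef_Mmonic ?monicXsubC.
have [|L [iota [r Dr]]] := IHn K g nzg.
  rewrite -ltnS (leq_trans _ le_hn) // -(size_map_poly j h).
  by rewrite [map_poly _ _]Dg size_Mmonic ?monicXsubC // size_XsubC addn2.
exists L, (iota \o j), (iota z :: r).
rewrite map_poly_comp [map_poly (GRing.in_alg _) _]Dg rmorphM /= Dr lg.
by rewrite big_cons rmorphB /= map_polyX map_polyC -scalerAl mulrC.
Qed.

Lemma disc_uniq (F : fieldType) (h : {poly F}) (D1 D2 : F) :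
  h != 0 -> is_disc h D1 -> is_disc h D2 -> D1 = D2.
Proof.
move=> nzh [L1 [i1 [r1 [/(is_disc_formula nzh) E1]]]].
move=> D1E [L2 [i2 [r2 [/(is_disc_formula nzh) E2]]]] D2E.
apply: (fmorph_inj i1); rewrite D1E -E1; congr (i1 _).
by apply: (fmorph_inj i2); rewrite D2E -E2.
Qed.

Lemma discP (F : fieldType) (h : {poly F}) :
  h != 0 -> size h != 2 -> is_disc h (disc h).
Proof.
move=> nzh /negPf h2; rewrite /disc h2; case: pselect => [ex|[]].
  exact: svalP (cid ex).
have [L [iota [r Dr]]] := splitting_ex nzh.
by eexists; exists L, iota, r; split; last exact: (is_disc_formula nzh Dr).
Qed.

(* Z_p is the inverse limit of the rings Z/p^n: the n-th entry is the
   representative in [0, p^n) of the class mod p^n, and coherence alone forces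
   it into that range. *)
Record padic_int (p : nat) (pr_p : prime p) := PadicInt {
  padic_res : nat -> int;
  _ : `[< forall n, padic_res n = (padic_res n.+1 %% (p ^ n)%:Z)%Z >]
}.

HB.instance Definition _ p (pr_p : prime p) := [isSub for @padic_res p pr_p].
HB.instance Definition _ p (pr_p : prime p) :=
  [Choice of padic_int pr_p by <:].

Section PadicRing.
Variables (p : nat) (pr_p : prime p).
Local Notation Zp := (padic_int pr_p).
Local Notation res := (@padic_res p pr_p).
Local Notation P n := (p ^ n)%:Z.
Implicit Types (x y z : Zp) (f g : nat -> int).

Lemma padic_resS x n : res x n = (res x n.+1 %% P n)%Z.
Proof. by case: x => r /= /asboolP; apply. Qed.

Lemma padic_eq x y : res x =1 res y -> x = y.
Proof. by move=> /funext; apply: val_inj. Qed.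

Lemma modz_exp (a : int) m n :
  (m <= n)%N -> ((a %% P n)%Z %% P m)%Z = (a %% P m)%Z.
Proof.
move=> le_mn; rewrite [in RHS](divz_eq a (P n)) -(subnK le_mn) expnD PoszM.
by rewrite mulrA modzMDl.
Qed.

Lemma padic_res_mod x n : (res x n %% P n)%Z = res x n.
Proof. by rewrite padic_resS modz_mod. Qed.

Lemma padic_res_le x m n : (m <= n)%N -> (res x n %% P m)%Z = res x m.
Proof.
move=> /subnK <-; elim: (n - m)%N => [|k IHk]; first exact: padic_res_mod.
rewrite -IHk addSn [in RHS]padic_resS modz_exp //; exact: leq_addl.
Qed.

Fact padic_mk_key f :
  (forall n, (f n %% P n)%Z = (f n.+1 %% P n)%Z) ->
  `[< forall n, (f n %% P n)%Z = ((f n.+1 %% P n.+1)%Z %% P n)%Z >].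
Proof. by move=> fP; apply/asboolP=> n; rewrite modz_exp. Qed.

Definition padic_mk f fP : Zp := PadicInt pr_p (@padic_mk_key f fP).

Fact padic_add_key x y n :
  ((res x n + res y n)%R %% P n)%Z = ((res x n.+1 + res y n.+1)%R %% P n)%Z.
Proof. by rewrite (padic_resS x) (padic_resS y) modzDm. Qed.

Fact padic_mul_key x y n :
  ((res x n * res y n)%R %% P n)%Z = ((res x n.+1 * res y n.+1)%R %% P n)%Z.
Proof. by rewrite (padic_resS x) (padic_resS y) modzMm. Qed.

Fact padic_opp_key x n : (- res x n %% P n)%Z = (- res x n.+1 %% P n)%Z.
Proof. by rewrite (padic_resS x) modzNm. Qed.

Fact padic_cst_key (a : int) n : (a %% P n)%Z = (a %% P n)%Z.
Proof. by []. Qed.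

Definition padic_cst a := padic_mk (padic_cst_key a).
Definition padic_add x y := padic_mk (padic_add_key x y).
Definition padic_mul x y := padic_mk (padic_mul_key x y).
Definition padic_opp x := padic_mk (padic_opp_key x).

Fact padic_addA : associative padic_add.
Proof. by move=> x y z; apply: padic_eq => n /=; rewrite modzDml modzDmr addrA. Qed.
Fact padic_addC : commutative padic_add.
Proof. by move=> x y; apply: padic_eq => n /=; rewrite addrC. Qed.
Fact padic_add0 : left_id (padic_cst 0) padic_add.
Proof. by move=> x; apply: padic_eq => n /=; rewrite mod0z add0r padic_res_mod. Qed.
Fact padic_addN : left_inverse (padic_cst 0) padic_opp padic_add.
Proof. by move=> x; apply: padic_eq => n /=; rewrite modzDml addNr. Qed.

HB.instance Definition _ := GRing.isZmodule.Build Zp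
  padic_addA padic_addC padic_add0 padic_addN.

Fact padic_mulA : associative padic_mul.
Proof. by move=> x y z; apply: padic_eq => n /=; rewrite modzMml modzMmr mulrA. Qed.
Fact padic_mulC : commutative padic_mul.
Proof. by move=> x y; apply: padic_eq => n /=; rewrite mulrC. Qed.
Fact padic_mul1 : left_id (padic_cst 1) padic_mul.
Proof. by move=> x; apply: padic_eq => n /=; rewrite modzMml mul1r padic_res_mod. Qed.
Fact padic_mulD : left_distributive padic_mul padic_add.
Proof.
by move=> x y z; apply: padic_eq => n /=; rewrite modzMml modzDm mulrDl.
Qed.
Fact padic_oner_neq0 : padic_cst 1 != 0.
Proof.
apply/eqP=> /(congr1 (fun x => res x 1)) /=; rewrite mod0z expn1 modz_small //.
by rewrite ltz_nat prime_gt1.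
Qed.

HB.instance Definition _ := GRing.Zmodule_isComNzRing.Build Zp
  padic_mulA padic_mulC padic_mul1 padic_mulD padic_oner_neq0.

Definition padic_unit : {pred Zp} := fun x => `[< exists y, y * x = 1 >].
Definition padic_inv x : Zp :=
  if pselect (exists y, y * x = 1) is left h then sval (cid h) else x.

Fact padic_mulV : {in padic_unit, left_inverse 1 padic_inv *%R}.
Proof.
move=> x /asboolP h; rewrite /padic_inv; case: pselect => [h'|//].
exact: svalP (cid h').
Qed.

Fact padic_unitPl x y : y * x = 1 -> padic_unit x.
Proof. by move=> yx1; apply/asboolP; exists y. Qed.

Fact padic_inv_out : {in [predC padic_unit], padic_inv =1 id}.
Proof.
move=> x /asboolPn h; rewrite /padic_inv; case: pselect => // h'.
Qed.

HB.instance Definition _ := GRing.ComNzRing_hasMulInverse.Build Zp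
  padic_mulV padic_unitPl padic_inv_out.

Fact padic_idomain (x y : Zp) : x * y = 0 -> (x == 0) || (y == 0).
Proof.
move=> xy0; apply/orP; apply: contrapT => /not_orP[/negP/eqP nzx /negP/eqP nzy].
have nzP z : z <> 0 -> exists n, res z n != 0.
  move=> nzz; apply: contrapT => /forallNP z0; apply: nzz.
  apply: padic_eq => n; rewrite [RHS]/= mod0z.
  by apply/eqP; have /negP := z0 n; rewrite negbK.
have [[a xa] [b yb]] := (nzP _ nzx, nzP _ nzy).
have /(congr1 (fun z => res z (a + b))) /= := xy0; rewrite mod0z.
have logP z m n : res z m != 0 -> (m <= n)%N ->
    (logn p `|res z n| < m)%N && (0 < `|res z n|)%N.
  move=> nz_zm le_mn; have:= nz_zm; rewrite -(padic_res_le z le_mn).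
  move/eqP/dvdz_mod0P; rewrite dvdzE /=; have [->|] := posnP.
    by rewrite dvdn0.
  by move=> z_gt0; rewrite pfactor_dvdn // -ltnNge andbT.
have /andP[lx x0] := logP _ _ (a + b)%N xa (leq_addr _ _).
have /andP[ly y0] := logP _ _ (a + b)%N yb (leq_addl _ _).
move/dvdz_mod0P; rewrite dvdzE /= abszM pfactor_dvdn ?muln_gt0 ?x0 //.
by rewrite lognM // leqNgt -addSn leq_add // ltnW.
Qed.

HB.instance Definition _ := GRing.ComUnitRing_isIntegral.Build Zp padic_idomain.

(* p^n divides x in Z_p *)
Definition padic_dvd (n : nat) (x : Zp) : Prop :=
  exists y : Zp, x = p%:R ^+ n * y.

(* The largest n such that p^n divides x, and +oo if there is none. *)
Definition padic_val (x : Zp) : \bar int :=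
  if pselect (exists n, ~~ `[< padic_dvd n.+1 x >]) is left h
  then (ex_minn h)%:Z%:E else +oo%E.

Lemma padic_res_nat (k n : nat) : res k%:R n = (k%:Z %% P n)%Z.
Proof.
elim: k => [//|k IHk]; rewrite mulrS [LHS]/= IHk modzDml modzDmr.
by rewrite -PoszD add1n.
Qed.

Lemma padic_dvdP n x : padic_dvd n x <-> res x n = 0.
Proof.
split=> [[y ->]|x0].
  by rewrite -natrX /= padic_res_nat modzz mul0r mod0z.
have Pgt0 m : 0 < P m by rewrite ltz_nat expn_gt0 prime_gt0.
pose f m := (res x (n + m) %/ P n)%Z.
have fE m : res x (n + m) = f m * P n.
  apply/eqP; rewrite eq_sym -dvdz_eq; apply/dvdz_mod0P.
  by rewrite (padic_res_le x (leq_addr m n)).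
have fP m : (f m %% P m)%Z = (f m.+1 %% P m)%Z.
  have := padic_resS x (n + m); rewrite -addnS !fE expnD PoszM mulrC.
  rewrite [f m.+1 * _]mulrC -mulz_modr // => /mulfI ->; last by rewrite gt_eqF.
  by rewrite modz_mod.
exists (padic_mk fP); apply: padic_eq => m /=.
rewrite -natrX padic_res_nat modzMml modzMmr mulrC -fE padic_res_le //.
exact: leq_addl.
Qed.

Lemma padic_val_eqP x n :
  padic_val x = n%:Z%:E <-> padic_dvd n x /\ ~ padic_dvd n.+1 x.
Proof.
have dvdW a b : (a <= b)%N -> padic_dvd b x -> padic_dvd a x.
  move=> le_ab /padic_dvdP xb; apply/padic_dvdP.
  by rewrite -(padic_res_le x le_ab) xb mod0z.
rewrite /padic_val; case: pselect => [h|/forallNP h].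
  case: ex_minnP => m /asboolPn ndv minm; split=> [[<-]|[dvn ndvn]].
    split=> //; case: m ndv minm => [|m] _ minm.
      by exists x; rewrite expr0 mul1r.
    apply: contrapT => ndv; suff : (m.+1 <= m)%N by rewrite ltnn.
    by apply/minm/asboolPn.
  congr (_%:Z%:E); apply/eqP; rewrite eqn_leq minm; last exact/asboolPn.
  by rewrite leqNgt; apply/negP=> lt_mn; apply/ndv/(dvdW _ _ lt_mn).
split=> // -[_ ndv]; have := h n; case; exact/asboolPn.
Qed.

Lemma padic_val_eqy x : padic_val x = +oo%E <-> x = 0.
Proof.
rewrite /padic_val; case: pselect => [h|/forallNP h]; split=> //.
- by move=> x0; case: h => n /asboolPn[]; exists 0; rewrite mulr0.
- move=> _; apply: padic_eq => n; rewrite [RHS]/= mod0z padic_resS.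
  have /negP := h n; rewrite negbK => /asboolP/padic_dvdP ->.
  by rewrite mod0z.
Qed.

Lemma padic_valM x y : padic_val (x * y) = (padic_val x + padic_val y)%E.
Proof.
have nz_p : p%:R != 0 :> Zp.
  apply/eqP=> /(congr1 (fun x => res x 2)); rewrite padic_res_nat /= mod0z.
  move/dvdz_mod0P; rewrite dvdzE /= -{2}(expn1 p) dvdn_Pexp2l //.
  exact: prime_gt1.
have decP z : z <> 0 -> exists n z',
    [/\ padic_val z = n%:Z%:E, z = p%:R ^+ n * z' & ~ padic_dvd 1 z'].
  move=> nzz; have : padic_val z <> +oo%E by move/padic_val_eqy.
  rewrite /padic_val; case: pselect => // h _.
  set m := ex_minn h; have /padic_val_eqP[[z' Dz] ndv] : padic_val z = m%:Z%:E.
    by rewrite /padic_val /m; case: pselect => // h'; congr (_%:Z%:E); apply: eq_ex_minn.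
  exists m, z'; split=> // -[u Dz']; apply: ndv; exists u.
  by rewrite exprSr -mulrA Dz {1}Dz' expr1.
have val0 : padic_val 0 = +oo%E by apply/padic_val_eqy.
have [->|/eqP/decP[m [x' [vx Dx ndvx]]]] := eqVneq x 0.
  rewrite mul0r val0; have [->|/eqP/decP[n [y' [-> _ _]]]] // := eqVneq y 0.
  by rewrite val0.
have [->|/eqP/decP[n [y' [vy Dy ndvy]]]] := eqVneq y 0.
  by rewrite mulr0 val0 vx.
rewrite vx vy -EFinD -PoszD; apply/padic_val_eqP; split.
  by exists (x' * y'); rewrite Dx Dy exprD; ring.
case=> u; rewrite Dx Dy => /esym E.
have {E} : p%:R * u = x' * y'.
  have nz : p%:R ^+ (m + n) != 0 :> Zp by rewrite expf_neq0.
  by apply: (mulfI nz); rewrite mulrA -exprSr E exprD; ring.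
move=> /esym E; have /padic_dvdP/= : padic_dvd 1 (x' * y') by exists u.
move/dvdz_mod0P; rewrite dvdzE abszM expn1 Euclid_dvdM // => /orP[] dv.
  by apply/ndvx/padic_dvdP; rewrite -padic_res_mod; apply/dvdz_mod0P; rewrite expn1.
by apply/ndvy/padic_dvdP; rewrite -padic_res_mod; apply/dvdz_mod0P; rewrite expn1.
Qed.

(* v_p(a/b) = v_p(a) - v_p(b) on Q_p; it does not depend on the fraction, see
   frac_val_div. *)
Definition frac_val (x : {fraction Zp}) : \bar int :=
  (padic_val (\n_(repr x)) - padic_val (\d_(repr x)))%E.

Lemma frac_val_div (a b : Zp) : b != 0 ->
  frac_val (FracField.tofrac a / FracField.tofrac b) = (padic_val a - padic_val b)%E.
Proof.
move=> nzb; set x := _ / _; rewrite /frac_val; set r := repr x.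
have nzd : \d_r != 0 by [].
have xd : x * FracField.tofrac \d_r = FracField.tofrac \n_r.
  rewrite -[x]reprK -/r; unlock FracField.tofrac; rewrite -[LHS]FracField.pi_mul.
  apply/eqmodP; rewrite /= FracField.equivfE /FracField.mulf.
  by rewrite !numden_Ratio ?mulf_neq0 ?oner_neq0 // !mulr1 mulrC.
have : \n_r * b = a * \d_r.
  apply/eqP; rewrite -tofrac_eq !tofracM -xd /x mulrAC divfK //.
  by rewrite tofrac_eq0.
move=> /(congr1 padic_val); rewrite !padic_valM.
have : padic_val \d_r <> +oo%E by move/padic_val_eqy/eqP; apply/negP.
have : padic_val b <> +oo%E by move/padic_val_eqy/eqP; apply/negP.
have ninf z : padic_val z <> -oo%E by rewrite /padic_val; case: pselect.
move: (ninf b) (ninf \d_r).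
case: (padic_val b) => // vb _; case: (padic_val \d_r) => // vd _ _ _.
case: (padic_val a) => [va||]; case: (padic_val \n_r) => [vn||] //=.
by rewrite -!EFinD => -[E]; congr (_%:E); lia.
Qed.
End PadicRing.

(* Irreducible as an element of R[x], and nonconstant.  Unlike irreducible_poly,
   which ignores scalar factors, this rules out a factor in R that is not a
   unit. *)
Definition irreducible_over (R : idomainType) (g : {poly R}) : Prop :=
  (1 < size g)%N /\
  forall a b : {poly R}, g = a * b ->
    a \is a GRing.unit \/ b \is a GRing.unit.

Section Factorization.
Variables (p : nat) (pr_p : prime p) (n m : nat).
Local Notation Zp := (padic_int pr_p).
Implicit Types (F : {poly Zp}) (alpha : 'I_n -> Zp) (g : 'I_m -> {poly Zp}).

(* F = unit * \prod_i (x - alpha_i)^(e_i) * \prod_j g_j^(t_j).  It follows that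
   the alpha_i are exactly the roots of F in Z_p, with multiplicities e_i.
   Since the g_j are nonconstant, such an F is primitive. *)
Record padic_factorization F alpha (e : 'I_n -> nat) g (t : 'I_m -> nat) :
    Prop := PadicFactorization {
  padic_factE : exists2 u : Zp, u \is a GRing.unit &
    F = u *: (\prod_(i < n) ('X - (alpha i)%:P) ^+ e i
              * \prod_(j < m) g j ^+ t j);
  padic_fact_inj : injective alpha;
  padic_fact_e : forall i, (0 < e i)%N;
  padic_fact_irr : forall j, irreducible_over (g j);
  padic_fact_noroot : forall j (a : Zp), ~~ root (g j) a;
  padic_fact_coprime : forall j1 j2, j1 != j2 -> coprimep (g j1) (g j2);
  padic_fact_t : forall j, (0 < t j)%N
}.

Definition padic_rad alpha g : {poly Zp} :=
  \prod_(i < n) ('X - (alpha i)%:P) * \prod_(j < m) g j.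

(* v_p (D (rad f)), the discriminant being taken over Q_p. *)
Definition padic_Delta alpha g : \bar int :=
  frac_val (disc (map_poly (@FracField.tofrac Zp) (padic_rad alpha g))).

End Factorization.

(* Main.v *)
Require Import Defs.
From mathcomp Require Import all_boot all_order all_algebra.
From mathcomp Require Import constructive_ereal perm boolp zify ring.

Set Implicit Arguments.
Unset Strict Implicit.
Unset Printing Implicit Defensive.
Import Order.TTheory GRing.Theory Num.Theory.
Local Open Scope ring_scope.

(** Write R for the radical, D for its discriminant, Delta for v(D), and a for
    the approximate root.  The whole argument runs on one algebraic fact: up to
    sign, D is the resultant of R and R', so D = A R + B R' with A, B in
    Z_p[x], as soon as deg R >= 2 ([disc_in_ideal]).  Suppose R = q s.  At a point b where
    v(q(b)) > Delta, every term of D = A q s + B (q' s + q s') other than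
    B q' s has valuation > Delta, so q'(b) s(b) must have valuation <= Delta
    ([rad_factor_deriv]).  This is used twice.

    - With q = x - alpha_i and b = alpha_i, it bounds
      v(alpha_i - alpha_j) <= Delta for j != i ([root_separation]).  Hence at
      most one root satisfies v(a - alpha_i) > Delta + 1, and such a root is
      closer to a than to any other root.

    - With q = g_j and b = a, it gives v(g_j'(a)) <= Delta as soon as
      v(g_j(a)) > Delta.  If even v(g_j(a)) > 2 Delta, then Hensel's lemma
      ([padic_hensel]) would produce a root of g_j in Z_p; so
      v(g_j(a)) <= 2 Delta ([noroot_factor_val]), which is at most
      deg(g_j) (Delta + 1) when deg(g_j) >= 2.  A linear g_j without a root in
      Z_p is primitive with leading coefficient divisible by p, so g_j(a) is a
      unit ([linear_noroot_val]).

    Now v(f(a)) = sum_i e_i v(a - alpha_i) + sum_j t_j v(g_j(a)).  If every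
    v(a - alpha_i) were at most Delta + 1, this sum would be at most
    d (Delta + 1) < k; so some alpha_i satisfies v(a - alpha_i) > Delta + 1.

    The resultant formula comes from multiplying the Sylvester matrix by a
    matrix that evaluates the row polynomials at the roots r_j of R: the rows
    x^i R become 0, the rows x^i R' become r_j^i R'(r_j), and a Vandermonde
    determinant factors out of both sides ([resultant_roots]). *)

(** * The resultant in terms of roots *)

Lemma split_lshift m n (i : 'I_m) : split (lshift n i) = inl i.
Proof. exact: (unsplitK (inl _ i)). Qed.

Lemma split_rshift m n (j : 'I_n) : split (rshift m j) = inr j.
Proof. exact: (unsplitK (inr _ j)). Qed.

(** Moves the block of the first s indices after the block of the last m, so
    that [eval_mx] below becomes block triangular. *)
Definition swap_blocks s m (k : 'I_(s + m)) : 'I_(s + m) :=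
  match split k with
  | inl i => cast_ord (addnC m s) (rshift m i)
  | inr j => cast_ord (addnC m s) (lshift s j)
  end.

Lemma swap_blocks_inj s m : injective (@swap_blocks s m).
Proof.
move=> k k'; rewrite /swap_blocks.
case: splitP => i Di; case: splitP => i' Di' /(congr1 val) /= E; apply: val_inj;
  by move: Di Di' (ltn_ord i) (ltn_ord i') E => /=; lia.
Qed.

(** Applied to the coefficients of polynomials of degree less than s + m, the
    first s columns read off the coefficients of degree at least m, and the last
    m columns evaluate at the points r_j. *)
Definition eval_mx (L : comNzRingType) s m (r : 'I_m -> L) : 'M[L]_(s + m) :=
  \matrix_(k, l) match split l with
    | inl i => (k == m + i :> nat)%:R
    | inr j => r j ^+ k
    end.

Lemma det_eval_mx (L : comNzRingType) s m (r : 'I_m -> L) :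
  exists b : bool, \det (eval_mx s r)
    = (-1) ^+ b * \det (Vandermonde m (\row_i r i)).
Proof.
pose sg := perm (@swap_blocks_inj s m); exists (odd_perm sg).
suff <- : \det (row_perm sg (eval_mx s r)) = \det (Vandermonde m (\row_i r i)).
  by rewrite row_permE det_mulmx det_perm signrMK.
rewrite -[row_perm _ _]submxK.
have -> : dlsubmx (row_perm sg (eval_mx s r)) = 0.
  apply/matrixP=> j i; rewrite !mxE permE /swap_blocks !split_rshift ?split_lshift /=.
  by rewrite (_ : _ == _ = false) //; have := ltn_ord j; lia.
rewrite det_ublock (_ : ulsubmx _ = 1%:M).
  rewrite det1 mul1r; congr (\det _); apply/matrixP=> j j'.
  by rewrite !mxE permE /swap_blocks !split_rshift.
apply/matrixP=> i i'; rewrite !mxE permE /swap_blocks !split_lshift /=.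
by rewrite eqn_add2l.
Qed.

(** The formula Res(h, q) = +/- c^(deg q) \prod_i q(r_i).  Both sides carry a
    Vandermonde factor, which vanishes when the r_i are not distinct: cancelling
    it is left to the caller, for whom that case is trivial. *)
Lemma resultant_roots (R L : comNzRingType) (f : {rmorphism R -> L})
    (h q : {poly R}) m (r : 'I_m -> L) : m = (size h).-1 ->
  map_poly f h = f (lead_coef h) *: \prod_(i < m) ('X - (r i)%:P) ->
  exists b : bool,
    f (resultant h q) * \det (Vandermonde m (\row_i r i))
    = (-1) ^+ b * (f (lead_coef h) ^+ (size q).-1
      * \prod_(i < m) (map_poly f q).[r i]) * \det (Vandermonde m (\row_i r i)).
Proof.
move=> Dm Dh; subst m; set m := (size h).-1 in r Dh *; set s := (size q).-1.
have [b Db] := det_eval_mx s r; exists b.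
set V := \det (Vandermonde _ _) in Db *.
rewrite -[LHS](signrMK b) -mulrA; congr (_ * _); rewrite mulrCA -Db.
pose S := Sylvester_mx h q : 'M_(s + m).
(* The row k of the Sylvester matrix lists the coefficients of w k. *)
pose w (k : 'I_(s + m)) : {poly R} :=
  match split k with inl i => 'X^i * h | inr j => 'X^j * q end.
have szM i (a : {poly R}) n : (i < n)%N -> (size ('X^i * a)%R <= n + (size a).-1)%N.
  move=> lt_in; rewrite mulrC (leq_trans (size_polyMleq _ _)) // size_polyXn.
  by have := lt_in; case: (size a); lia.
have szw k : (size (w k) <= s + m)%N.
  rewrite /w; case: (split k) => j; first exact: szM.
  by rewrite addnC; apply: szM.
have SE k l : S k l = (w k)`_l.
  rewrite /S Sylvester_mxE /w; case: (split k) => j;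
    by rewrite coefXnM ltnNge if_neg -mulrb.
pose Sf := map_mx f S.
have -> : f (resultant h q) = \det Sf by rewrite det_map_mx.
have SfE k l : Sf k l = f (w k)`_l by rewrite mxE SE.
rewrite -det_mulmx; clearbody Sf => {S SE}.
have evE k (j : 'I_m) :
    (Sf *m eval_mx s r) k (rshift s j) = (map_poly f (w k)).[r j].
  rewrite mxE (@horner_coef_wide _ (s + m)) ?(leq_trans (size_poly _ _)) //.
  by apply: eq_bigr => l _; rewrite !mxE SfE split_rshift coef_map.
have coE k (i : 'I_s) :
    (Sf *m eval_mx s r) k (lshift m i) = f (w k)`_(m + i).
  have lt_mi : (m + i < s + m)%N by rewrite addnC ltn_add2r.
  rewrite mxE (bigD1 (Ordinal lt_mi)) //= big1 => [|l ne_l].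
    by rewrite !mxE SfE split_lshift eqxx mulr1 addr0.
  rewrite !mxE split_lshift (_ : _ == _ = false) ?mulr0 //.
  by apply: contraNF ne_l => /eqP E; apply/eqP/val_inj.
have hr0 j : (map_poly f h).[r j] = 0.
  by rewrite Dh hornerZ horner_prod (bigD1 j) //= hornerXsubC subrr mul0r mulr0.
(* The product is block lower triangular: x^i h vanishes at the roots of h. *)
rewrite -[_ *m _]submxK.
have -> : ursubmx (Sf *m eval_mx s r) = 0.
  apply/matrixP=> i j; rewrite 2![LHS]mxE evE /w split_lshift.
  by rewrite rmorphM hornerM hr0 mulr0 mxE.
rewrite det_lblock -mulrA; congr (_ * _); last first.
  have -> : drsubmx (Sf *m eval_mx s r) = Vandermonde m (\row_i r i)
      *m diag_mx (\row_j (map_poly f q).[r j]).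
    apply/matrixP=> i j; rewrite 2![LHS]mxE evE /w split_rshift mul_mx_diag.
    by rewrite rmorphM hornerM /= map_polyXn hornerXn !mxE.
  rewrite det_mulmx mulrC det_diag; congr (_ * _).
  by apply: eq_bigr => j _; rewrite mxE.
(* The coefficients of degree m + i' of the x^i h form a triangular block
   with the leading coefficient of h on the diagonal. *)
have ulE (i i' : 'I_s) : ulsubmx (Sf *m eval_mx s r) i i' =
    f (if (m + i' < i)%N then 0 else h`_(m + i' - i)).
  by rewrite 2![LHS]mxE coE /w split_lshift coefXnM.
rewrite det_trig; last first.
  apply/is_trig_mxP=> i i' lt_ii'; rewrite ulE; case: ifP => _; rewrite ?raddf0 //.
  rewrite nth_default ?raddf0 //.
  by move: lt_ii'; rewrite /m; case: (size h) => [|n] /=; lia.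
rewrite (eq_bigr (fun=> f (lead_coef h))) ?prodr_const ?card_ord // => i _.
by rewrite ulE ltnNge leq_addl /= addnK.
Qed.

(** * The discriminant lies in the ideal of a polynomial and its derivative *)

Lemma det_Vandermonde_sqr (L : comNzRingType) m (r : 'I_m -> L) :
  \det (Vandermonde m (\row_i r i)) ^+ 2
  = \prod_(i < m) \prod_(j < m | (i < j)%N) (r i - r j) ^+ 2.
Proof.
rewrite det_Vandermonde -prodrXl; apply: eq_bigr => i _.
rewrite -prodrXl; apply: eq_bigr => j _.
by rewrite !mxE -[in RHS]opprB sqrrN.
Qed.

Lemma prod_offdiag (L : comNzRingType) m (r : 'I_m -> L) :
  exists b : bool,
    \prod_(i < m) \prod_(j < m | j != i) (r i - r j)
    = (-1) ^+ b * \prod_(i < m) \prod_(j < m | (i < j)%N) (r i - r j) ^+ 2.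
Proof.
pose N := (\sum_(i < m) \sum_(j < m | (i < j)%N) 1)%N; exists (odd N).
have -> : \prod_(i < m) \prod_(j < m | j != i) (r i - r j)
  = \prod_(i < m) \prod_(j < m | (i < j)%N) (r i - r j)
    * \prod_(i < m) \prod_(j < m | (j < i)%N) (r i - r j).
  rewrite -big_split; apply: eq_bigr => i _.
  rewrite (bigID (fun j : 'I_m => (i < j)%N)) /=; congr (_ * _);
    by apply: eq_bigl => j; rewrite -(inj_eq val_inj) /=; lia.
rewrite [X in _ * X](exchange_big_dep xpredT) //= -big_split signr_odd.
rewrite -prodrXr -big_split; apply: eq_bigr => i _ /=.
rewrite -prodrXr -!big_split; apply: eq_bigr => j _ /=.
by rewrite -[r j - r i]opprB; ring.
Qed.

Lemma size_deriv_char0 (R : idomainType) (h : {poly R}) :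
  (forall n, n.+1%:R != 0 :> R) -> size h^`() = (size h).-1.
Proof.
move=> chR; have [le_h1|lt_1h] := leqP (size h) 1.
  rewrite (size1_polyC le_h1) derivC size_poly0; move: le_h1.
  by rewrite size_polyC; case: eqP.
apply/eqP; rewrite eqn_leq; apply/andP; split.
  rewrite -ltnS prednK ?(ltnW lt_1h) // lt_size_deriv //.
  by rewrite -size_poly_gt0 (ltnW lt_1h).
case Dn: (size h) lt_1h => [|[|n]] //= _; rewrite ltnNge; apply/negP=> le_n.
have /eqP := nth_default 0 le_n; rewrite coef_deriv -mulr_natr mulf_eq0.
rewrite (negPf (chR _)) orbF; have := lead_coef_eq0 h.
by rewrite lead_coefE Dn /= => ->; rewrite -size_poly_eq0 Dn.
Qed.

Lemma deriv_prod_root (L : comNzRingType) (c : L) m (r : 'I_m -> L) (i : 'I_m) :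
  ((c *: \prod_(j < m) ('X - (r j)%:P))^`()).[r i]
  = c * \prod_(j < m | j != i) (r i - r j).
Proof.
rewrite (bigD1 i) //= derivZ derivM derivXsubC mul1r hornerZ hornerD hornerM.
rewrite hornerXsubC subrr mul0r addr0 horner_prod; congr (_ * _).
by apply: eq_bigr => j _; rewrite hornerXsubC.
Qed.

(** D = +/- Res(h, h'), and a resultant is a combination of its arguments over
    the ring of coefficients.  The identity is computed from the roots in an
    extension L of F, but it descends to R because R embeds in L.  In degree at
    most 1 the discriminant is 1, which need not lie in the ideal: take h = c x
    with c not a unit. *)
Lemma disc_in_ideal (R : idomainType) (F : fieldType) (iota : {rmorphism R -> F})
    (h : {poly R}) :
  injective iota -> (forall n, n.+1%:R != 0 :> R) -> h != 0 ->
  exists2 x : R, disc (map_poly iota h) = iota x &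
    if (size h <= 2)%N then x = 1 else
    exists A B : {poly R}, x%:P = A * h + B * h^`().
Proof.
move=> iota_inj chR nzh.
have szi : size (map_poly iota h) = size h by rewrite size_map_inj_poly ?rmorph0.
have nzi : map_poly iota h != 0 by rewrite -size_poly_eq0 szi size_poly_eq0.
case: (ltngtP (size h) 2) => [lt_h2|lt_2h|eq_h2]; last first.
- by exists 1 => //; rewrite /disc szi eq_h2 rmorph1.
- have /(discP nzi) [L [io [r [Dh Ddisc]]]] : size (map_poly iota h) != 2.
    by rewrite szi gtn_eqF.
  have m_eq : (size (map_poly iota h)).-1 = (size h).-1 by rewrite szi.
  have [|b1] := @resultant_roots R L (io \o iota) h h^`() _ (tnth r) m_eq.
    by rewrite map_poly_comp Dh lead_coef_map_inj ?rmorph0.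
  have [b2] := prod_offdiag (tnth r).
  set m := (size _).-1 in r Dh Ddisc m_eq *.
  set V := \det _.
  set D := \prod_(i < m) \prod_(j < m | (i < j)%N) _ in Ddisc * => offD ResV.
  have V2D : V ^+ 2 = D by rewrite /V det_Vandermonde_sqr.
  set c := (io \o iota) (lead_coef h) in ResV.
  have cE : io (lead_coef (map_poly iota h)) = c.
    by rewrite lead_coef_map_inj ?rmorph0.
  have derE : \prod_(i < m) (map_poly (io \o iota) h^`()).[tnth r i]
      = c ^+ m * ((-1) ^+ b2 * D).
    rewrite -offD -[X in c ^+ X](card_ord m) -prodr_const -big_split /=.
    apply: eq_bigr => i _.
    by rewrite -deriv_map map_poly_comp Dh deriv_prod_root cE.
  (* If two roots coincide then D = V^2 = 0; otherwise V can be cancelled. *)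
  have [V0|nzV] := eqVneq V 0.
    exists 0; last by exists 0, 0; rewrite !mul0r addr0.
    by apply: (fmorph_inj io); rewrite Ddisc -V2D V0 expr0n mulr0 !rmorph0.
  have {ResV} := mulIf nzV ResV; rewrite derE size_deriv_char0 // => ResD.
  exists ((-1) ^+ (b1 (+) b2) * resultant h h^`()).
    apply: (fmorph_inj io); rewrite Ddisc cE rmorphM rmorph_sign rmorphM rmorph_sign.
    rewrite [io (iota _)]ResD (_ : 2 * m - 1 = (size h).-1.-1 + m)%N; last by lia.
    by rewrite exprD; case: (b1); case: (b2); rewrite /= ?expr0 ?expr1; ring.
  have [||[A B] /= _ resE] := @resultant_in_ideal R h h^`(); first exact: ltnW.
    by rewrite size_deriv_char0 // -subn1 ltn_subRL.
  exists ((-1) ^+ (b1 (+) b2) *: A), ((-1) ^+ (b1 (+) b2) *: B).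
  by rewrite -!scalerAl -scalerDr -resE -mul_polyC polyCM.
- exists 1; last by [].
  have [|L [io [r [_ DD]]]] := discP nzi; first by rewrite szi ltn_eqF.
  have m0 : (size (map_poly iota h)).-1 = 0%N by rewrite szi; lia.
  apply: (fmorph_inj io); rewrite DD rmorph1 rmorph1 big1 => [|i _].
    by rewrite m0 expr0 mulr1.
  by have := ltn_ord i; rewrite [X in (_ < X)%N]m0.
Qed.

(** * Divisibility and valuation of p-adic integers *)

Section PadicArithmetic.
Variables (p : nat) (pr_p : prime p).
Local Notation Zp := (padic_int pr_p).
Implicit Types x y : Zp.

Lemma padic_dvdW n k x : (k <= n)%N -> padic_dvd n x -> padic_dvd k x.
Proof.
by move=> /subnKC <- [y ->]; exists (p%:R ^+ (n - k) * y); rewrite mulrA -exprD.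
Qed.

Lemma padic_dvdD n x y : padic_dvd n x -> padic_dvd n y -> padic_dvd n (x + y).
Proof. by move=> [a ->] [b ->]; exists (a + b); rewrite mulrDr. Qed.

Lemma padic_dvdMl n x y : padic_dvd n y -> padic_dvd n (x * y).
Proof. by move=> [b ->]; exists (x * b); rewrite mulrCA. Qed.

Lemma padic_dvdMr n x y : padic_dvd n x -> padic_dvd n (x * y).
Proof. by rewrite mulrC; apply: padic_dvdMl. Qed.

Lemma padic_dvdB n x y : padic_dvd n x -> padic_dvd n y -> padic_dvd n (x - y).
Proof. by move=> dx dy; rewrite -mulN1r; apply/padic_dvdD/padic_dvdMl. Qed.

Lemma padic_dvd_sub n x y : padic_dvd n (x - y) <-> padic_res x n = padic_res y n.
Proof.
split=> [[z] /(congr1 (+%R^~ y))|Exy].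
  rewrite subrK => ->; rewrite -natrX /= padic_res_nat modzz mul0r mod0z add0r.
  exact: padic_res_mod.
by apply/padic_dvdP; rewrite /= modzDmr Exy subrr mod0z.
Qed.

Lemma padic_dvd_eq0 x : (forall n, padic_dvd n x) -> x = 0.
Proof.
by move=> dvx; apply: padic_eq => n; rewrite [RHS]/= mod0z; apply/padic_dvdP.
Qed.

Lemma padic_val_finite x : x != 0 -> exists n : nat, padic_val x = n%:Z%:E.
Proof.
move=> /eqP nzx; have := contra_not (@padic_val_eqy _ pr_p x).1 nzx.
by rewrite /padic_val; case: pselect => // h _; eexists.
Qed.

Lemma padic_val_geP n x : (n%:Z%:E <= padic_val x)%E <-> padic_dvd n x.
Proof.
have [->|/padic_val_finite[k vx]] := eqVneq x 0.
  by rewrite (padic_val_eqy 0).2 // leey; split=> // _; exists 0; rewrite mulr0.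
have [dk ndk] := (@padic_val_eqP _ pr_p x k).1 vx.
rewrite vx lee_fin lez_nat; split=> [le_nk|dn]; first exact: padic_dvdW dk.
by rewrite leqNgt; apply/negP=> lt_kn; apply/ndk/(padic_dvdW lt_kn).
Qed.

Lemma padic_val_leP n x : (padic_val x <= n%:Z%:E)%E <-> ~ padic_dvd n.+1 x.
Proof.
rewrite -padic_val_geP; have [->|/padic_val_finite[k ->]] := eqVneq x 0.
  by rewrite (padic_val_eqy 0).2 //; split=> // /(_ (leey _)).
by rewrite !lee_fin !lez_nat leqNgt; split=> [/negP|] // /negP.
Qed.

(** Invert x modulo each p^n by Bezout; inverses are unique, hence
    coherent. *)
Lemma padic_unitP x : ~ padic_dvd 1 x -> x \is a GRing.unit.
Proof.
move=> ndx.
have invP n : exists y : int, (y * padic_res x n = 1 %[mod (p ^ n)%:Z])%Z.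
  case: n => [|n]; first by exists 0; rewrite !modz1.
  have cop : coprimez (padic_res x n.+1) (p ^ n.+1)%:Z.
    rewrite coprimezE absz_nat coprimeXr // coprime_sym prime_coprime //.
    apply/negP=> dv; apply/ndx/padic_dvdP; rewrite -(@padic_res_le _ _ x 1 n.+1) //.
    by apply/dvdz_mod0P; rewrite dvdzE expn1.
  have [u [v Duv]] := Bezoutz (padic_res x n.+1) (p ^ n.+1)%:Z.
  by exists u; rewrite -[X in _ = (X %% _)%Z](eqP cop) -Duv addrC modzMDl.
have [y yP] := choice invP.
have yS n : (y n %% (p ^ n)%:Z)%Z = (y n.+1 %% (p ^ n)%:Z)%Z.
  have E1 : (y n.+1 * padic_res x n = 1 %[mod (p ^ n)%:Z])%Z.
    rewrite padic_resS modzMmr -(@modz_exp p _ n n.+1) // yP modz_exp //.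
  rewrite -[in LHS](mulr1 (y n)) -modzMmr -E1 modzMmr mulrCA.
  by rewrite -modzMmr yP modzMmr mulr1.
apply/unitrP; exists (padic_mk pr_p yS); suff E : padic_mk pr_p yS * x = 1.
  by split=> //; rewrite mulrC.
by apply: padic_eq => n /=; rewrite modzMml yP.
Qed.

Lemma padic_unit_dvd x : x \is a GRing.unit -> ~ padic_dvd 1 x.
Proof.
move=> Ux /(padic_dvdMr x^-1); rewrite mulrV // => /padic_dvdP/=.
by rewrite expn1 modz_small // ltz_nat prime_gt1.
Qed.

Lemma padic_val_unit x : x \is a GRing.unit -> padic_val x = 0%N%:Z%:E.
Proof.
move=> Ux; apply/padic_val_eqP; split; last exact: padic_unit_dvd.
by exists x; rewrite expr0 mul1r.
Qed.

Lemma padic_val_leM x y (m n : nat) : (padic_val x <= m%:Z%:E)%E ->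
  (padic_val y <= n%:Z%:E)%E -> (padic_val (x * y)%R <= (m + n)%N%:Z%:E)%E.
Proof. by rewrite padic_valM PoszD EFinD; apply: leeD. Qed.

Lemma padic_val_leX x (m n : nat) : (padic_val x <= m%:Z%:E)%E ->
  (padic_val (x ^+ n)%R <= (n * m)%N%:Z%:E)%E.
Proof.
move=> le_xm; elim: n => [|n IHn]; first by rewrite padic_val_unit ?unitr1.
by rewrite exprS mulSn; apply: padic_val_leM.
Qed.

Lemma padic_val_le_prod (I : finType) (x : I -> Zp) (m : I -> nat) :
  (forall i, padic_val (x i) <= (m i)%:Z%:E)%E ->
  (padic_val (\prod_i x i)%R <= (\sum_i m i)%N%:Z%:E)%E.
Proof.
move=> le_xm; pose K y n := (padic_val y <= n%:Z%:E)%E.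
apply: (big_ind2 K) => [|y1 n1 y2 n2|i _]; rewrite /K //.
  by rewrite padic_val_unit ?unitr1.
exact: padic_val_leM.
Qed.

Lemma frac_val_tofrac x : frac_val (FracField.tofrac x) = padic_val x.
Proof.
rewrite -[FracField.tofrac x]divr1 -tofrac1 frac_val_div ?oner_neq0 //.
by rewrite (padic_val_unit (unitr1 _)) sube0.
Qed.

Lemma padic_natr_neq0 n : n.+1%:R != 0 :> Zp.
Proof.
apply/eqP=> /(congr1 (fun x => padic_res x n.+1)); rewrite padic_res_nat /= mod0z.
by rewrite modz_small // ltz_nat ltn_expl ?prime_gt1.
Qed.

(** The limit has the n-th residue of u n as its n-th residue. *)
Lemma padic_complete (u : nat -> Zp) :
  (forall n, padic_dvd n (u n.+1 - u n)) ->
  exists b, forall n, padic_dvd n (b - u n).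
Proof.
move=> cu.
have fP n : (padic_res (u n) n %% (p ^ n)%:Z
    = padic_res (u n.+1) n.+1 %% (p ^ n)%:Z)%Z.
  by rewrite padic_res_mod -padic_resS; apply/esym/padic_dvd_sub.
exists (padic_mk pr_p fP) => n; apply/padic_dvd_sub => /=.
exact: padic_res_mod.
Qed.

End PadicArithmetic.

(** * Hensel's lemma *)

Lemma horner_sub_dvd (R : comNzRingType) (g : {poly R}) (a b : R) :
  exists q, g.[b] = g.[a] + (b - a) * q.
Proof.
have /factor_theorem[q Dq] : root (g - g.[a]%:P) a.
  by rewrite rootE !hornerE subrr.
exists q.[b]; rewrite -[g in LHS](subrK g.[a]%:P) Dq.
by rewrite hornerD hornerM hornerXsubC hornerC addrC mulrC.
Qed.

Lemma horner_taylor2 (R : comNzRingType) (g : {poly R}) (a b : R) :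
  exists q, g.[b] = g.[a] + (b - a) * g^`().[a] + (b - a) ^+ 2 * q.
Proof.
have /factor_theorem[q Dq] : root (g - g.[a]%:P) a.
  by rewrite rootE !hornerE subrr.
have Dg : g = q * ('X - a%:P) + g.[a]%:P by rewrite -Dq subrK.
have -> : g^`().[a] = q.[a].
  by rewrite Dg derivD derivM derivXsubC derivC !hornerE subrr mulr0 add0r.
have [r Dr] := horner_sub_dvd q a b; exists r.
by rewrite [in LHS]Dg hornerD hornerM hornerXsubC hornerC Dr; ring.
Qed.

Section Hensel.
Variables (p : nat) (pr_p : prime p).
Local Notation Zp := (padic_int pr_p).
Implicit Types (a : Zp) (g : {poly Zp}).

(** Newton's iteration a - g(a)/g'(a), for v(g'(a)) = s.  It moves a by a
    multiple of p^(s+n+1), so v(g'(a)) does not change, and the second order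
    Taylor remainder is divisible by p^(2s+2n+2). *)
Lemma newton_step g s n a (u : Zp) :
  u \is a GRing.unit -> g^`().[a] = p%:R ^+ s * u ->
  padic_dvd (s + s + n).+1 g.[a] ->
  exists b, [/\ padic_dvd n (b - a), padic_dvd (s + s + n.+1).+1 g.[b] &
    exists2 v, v \is a GRing.unit & g^`().[b] = p%:R ^+ s * v].
Proof.
move=> Uu Dg' [w Dg]; pose dl := - (p%:R ^+ (s + n).+1 * (w * u^-1)).
exists (a + dl); have subE : a + dl - a = dl by rewrite addrC addKr.
rewrite subE; split.
- apply: (padic_dvdW (n := (s + n).+1)); first by lia.
  by exists (- (w * u^-1)); rewrite mulrN.
- have [q ->] := horner_taylor2 g a (a + dl); rewrite subE Dg Dg'.
  exists (p%:R ^+ n * ((w * u^-1) ^+ 2 * q)).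
  have -> : p%:R ^+ (s + s + n).+1 * w + dl * (p%:R ^+ s * u) = 0.
    have -> : (s + s + n).+1 = ((s + n).+1 + s)%N by lia.
    rewrite exprD /dl; apply/eqP; rewrite mulNr subr_eq0; apply/eqP.
    by rewrite -[w in LHS](divrK Uu); ring.
  rewrite add0r /dl sqrrN exprMn -exprM [RHS]mulrA -exprD -mulrA.
  by congr (_ ^+ _ * _); lia.
have [q ->] := horner_sub_dvd g^`() a (a + dl).
rewrite subE Dg'; exists (u - p%:R * (p%:R ^+ n * (w * u^-1) * q)).
  apply: padic_unitP => dv; apply: (padic_unit_dvd Uu).
  rewrite -[u](subrK (p%:R * (p%:R ^+ n * (w * u^-1) * q))).
  by apply: padic_dvdD dv _; eexists; rewrite expr1.
by rewrite /dl -addnS exprD exprS; ring.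
Qed.

Lemma padic_hensel g s a :
  padic_val g^`().[a] = s%:Z%:E -> padic_dvd (s + s).+1 g.[a] ->
  exists b, root g b.
Proof.
move=> /padic_val_eqP[[u Du] ndu] dva.
have Uu : u \is a GRing.unit.
  apply: padic_unitP => -[w Dw]; apply: ndu; exists w.
  by rewrite Du Dw expr1 exprSr mulrA.
pose P n b := padic_dvd (s + s + n).+1 g.[b]
  /\ exists2 v, v \is a GRing.unit & g^`().[b] = p%:R ^+ s * v.
(* The implication makes the step total, so that it can be iterated. *)
have step (z : nat * Zp) : exists b, P z.1 z.2 -> padic_dvd z.1 (b - z.2) /\ P z.1.+1 b.
  have [[dv [v Uv Dv]]|nP] := pselect (P z.1 z.2); last by exists 0.
  by have [b [d1 d2 d3]] := newton_step Uv Dv dv; exists b.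
have [nxt nxtP] := choice step.
pose a_ := fix a_ n := if n is k.+1 then nxt (k, a_ k) else a.
have aP n : P n (a_ n).
  elim: n => [|n IHn]; first by rewrite /P addn0; split=> //; exists u.
  by have [] := nxtP (n, a_ n) IHn.
have [b bP] : exists b, forall n, padic_dvd n (b - a_ n).
  by apply: padic_complete => n; have [] := nxtP (n, a_ n) (aP n).
exists b; apply/eqP/padic_dvd_eq0 => n.
have [q ->] := horner_sub_dvd g (a_ n) b; apply: padic_dvdD; last exact: padic_dvdMr.
by apply: padic_dvdW (aP n).1; lia.
Qed.

End Hensel.

(** * The factors of the radical *)

Lemma degM (R : idomainType) (q r : {poly R}) : q != 0 -> r != 0 ->
  (size (q * r)%R).-1 = ((size q).-1 + (size r).-1)%N.
Proof.
move=> nzq nzr; rewrite size_mul //.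
move: nzq nzr; rewrite -!size_poly_gt0.
by case: (size q) => // a; case: (size r) => //= b; lia.
Qed.

Lemma deg_prod (R : idomainType) (I : finType) (q : I -> {poly R}) :
  (forall i, q i != 0) ->
  (size (\prod_i q i)%R).-1 = (\sum_i (size (q i)).-1)%N.
Proof.
move=> nzq; pose K (r : {poly R}) n := r != 0 /\ (size r).-1 = n.
suff [] : K (\prod_i q i) (\sum_i (size (q i)).-1)%N by [].
apply: (big_ind2 K) => [|r1 n1 r2 n2 [nz1 <-] [nz2 <-]|i _]; rewrite /K //.
  by rewrite oner_neq0 size_poly1.
by rewrite mulf_neq0 // degM.
Qed.

(** Let g = c_0 + c_1 x.  If c_1 were a unit then -c_0/c_1 would be a root, so p
    divides c_1.  If p also divided g(a) then it would divide c_0, and p itself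
    would be a factor of g. *)
Lemma linear_noroot_val (p : nat) (pr_p : prime p) (g : {poly padic_int pr_p})
    (a : padic_int pr_p) : irreducible_over g -> size g = 2%N ->
  (forall b, ~~ root g b) -> ~ padic_dvd 1 g.[a].
Proof.
move=> [_ irr] sz2 nr dva.
have Dg b : g.[b] = g`_0 + g`_1 * b.
  by rewrite horner_coef sz2 !big_ord_recl big_ord0 /= expr0 expr1 mulr1 addr0.
have [[c1 Dc1]|/padic_unitP U1] := pselect (padic_dvd 1 g`_1); last first.
  have /negP := nr (- (g`_0 / g`_1)); apply; rewrite rootE Dg.
  by rewrite mulrN mulrC divrK // subrr.
have [c0 Dc0] : padic_dvd 1 g`_0.
  rewrite (_ : g`_0 = g.[a] - g`_1 * a); last by rewrite Dg addrK.
  by apply: padic_dvdB dva _; apply: padic_dvdMr; exists c1.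
have Ep : g = (p%:R)%:P * (c0%:P + c1%:P * 'X).
  apply/polyP=> i; rewrite coefCM coefD coefC coefCM coefX.
  case: i => [|[|i]] /=; rewrite ?mulr0 ?addr0 ?mulr1 ?add0r.
  - by rewrite Dc0 expr1.
  - by rewrite Dc1 expr1.
  - by rewrite mulr0 nth_default // sz2.
have [] := irr _ _ Ep; rewrite poly_unitE.
  case/andP=> _; rewrite coefC eqxx => /padic_unit_dvd[].
  by exists 1; rewrite mulr1.
case/andP=> /eqP sz1 _; move: sz2; rewrite Ep.
have := size_polyMleq (p%:R : padic_int pr_p)%:P (c0%:P + c1%:P * 'X).
rewrite sz1 => le2 sz2; move: le2; rewrite sz2.
by have := size_polyC_leq1 (p%:R : padic_int pr_p); case: (size _) => [|[|]].
Qed.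

Section Factors.
Variables (p : nat) (pr_p : prime p) (n m : nat).
Local Notation Zp := (padic_int pr_p).
Variables (alpha : 'I_n -> Zp) (g : 'I_m -> {poly Zp}).
Hypothesis nzg : forall j, g j != 0.

Lemma deg_rad : (size (padic_rad alpha g)).-1 = (n + \sum_(j < m) (size (g j)).-1)%N.
Proof.
have nzX (i : 'I_n) : 'X - (alpha i)%:P != 0 by rewrite polyXsubC_eq0.
rewrite /padic_rad degM ?deg_prod //; try exact/prodf_neq0.
congr (_ + _)%N; rewrite (eq_bigr (fun=> 1%N)) ?sum1_card ?card_ord // => i _.
by rewrite size_XsubC.
Qed.

(** The discriminant, defined in the fraction field, is a p-adic integer; so
    Delta is the valuation of an element of Z_p and is nonnegative. *)
Lemma padic_DeltaP : exists2 D : Zp, padic_Delta alpha g = padic_val D &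
  if (size (padic_rad alpha g) <= 2)%N then D = 1 else
  exists A B : {poly Zp},
    D%:P = A * padic_rad alpha g + B * (padic_rad alpha g)^`().
Proof.
have nzR : padic_rad alpha g != 0.
  by rewrite mulf_neq0 //; apply/prodf_neq0=> i _; rewrite ?polyXsubC_eq0.
have tofrac_inj : injective (@FracField.tofrac Zp).
  by move=> x y /eqP; rewrite tofrac_eq => /eqP.
have [D DD DP] := disc_in_ideal tofrac_inj (@padic_natr_neq0 p pr_p) nzR.
by exists D => //; rewrite /padic_Delta [disc _]DD frac_val_tofrac.
Qed.

Variables (D : Zp) (A B : {poly Zp}) (N : nat).
Hypothesis DE : D%:P = A * padic_rad alpha g + B * (padic_rad alpha g)^`().
Hypothesis vD : padic_val D = N%:Z%:E.

(** In D = A q s + B (q' s + q s'), every term but B q' s is a multiple of q. *)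
Lemma rad_factor_deriv q s b : padic_rad alpha g = q * s ->
  padic_dvd N.+1 q.[b] -> ~ padic_dvd N.+1 (q^`().[b] * s.[b]).
Proof.
move=> Dqs dq dq'; have [_] := (padic_val_eqP D N).1 vD; apply.
rewrite -(hornerC D b) DE Dqs hornerD !hornerM derivM.
rewrite hornerD !hornerM; apply: padic_dvdD; apply: padic_dvdMl.
  exact: padic_dvdMr.
by apply: padic_dvdD => //; apply: padic_dvdMr.
Qed.

(** At alpha_i, D = B(alpha_i) R'(alpha_i), and R'(alpha_i) is a multiple of
    alpha_i - alpha_j. *)
Lemma root_separation i j : j != i -> ~ padic_dvd N.+1 (alpha i - alpha j).
Proof.
move=> ne_ji dij.
pose s := \prod_(l < n | l != i) ('X - (alpha l)%:P) * \prod_(l < m) g l.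
have Dqs : padic_rad alpha g = ('X - (alpha i)%:P) * s.
  by rewrite /padic_rad (bigD1 i) //= mulrA.
apply: (rad_factor_deriv (b := alpha i) Dqs).
  by rewrite hornerXsubC subrr; exists 0; rewrite mulr0.
rewrite derivXsubC hornerC mul1r hornerM (bigD1 j) //= hornerM hornerXsubC.
by rewrite -mulrA; apply: padic_dvdMr.
Qed.

(** Were v(g_j(b)) > 2 N, Hensel's lemma would apply to g_j at b, since
    v(g_j'(b)) <= N. *)
Lemma noroot_factor_val j b :
  (forall a, ~~ root (g j) a) -> ~ padic_dvd (N + N).+1 (g j).[b].
Proof.
move=> nr dgb.
pose s := \prod_(i < n) ('X - (alpha i)%:P) * \prod_(l < m | l != j) g l.
have Dqs : padic_rad alpha g = g j * s.
  by rewrite /padic_rad [X in _ * X](bigD1 j) //= mulrCA.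
have ndg' : ~ padic_dvd N.+1 (g j)^`().[b].
  move=> dg'; apply: (rad_factor_deriv (b := b) Dqs).
    by apply: padic_dvdW dgb; lia.
  exact: padic_dvdMr.
have [k [le_kN vk]] : exists k, (k <= N)%N /\ padic_val (g j)^`().[b] = k%:Z%:E.
  have nzg' : (g j)^`().[b] != 0.
    by apply/eqP=> g'0; apply: ndg'; rewrite g'0; exists 0; rewrite mulr0.
  have [k vk] := padic_val_finite nzg'; exists k; split=> //.
  by move/padic_val_leP: ndg'; rewrite vk lee_fin lez_nat.
have [a ra] : exists a, root (g j) a.
  by apply: (padic_hensel vk); apply: padic_dvdW dgb; lia.
by have /negP := nr a.
Qed.

End Factors.

(** * The nearest root *)

Theorem lemma13 (f : {poly int}) (d p : nat) (pr_p : prime p) (n m : nat)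
    (alpha : 'I_n -> padic_int pr_p) (e : 'I_n -> nat)
    (g : 'I_m -> {poly padic_int pr_p}) (t : 'I_m -> nat)
    (k : nat) (abar : padic_int pr_p) :
  let fp : {poly padic_int pr_p} := map_poly intr f in
  let Delta := padic_Delta alpha g in
  size f = d.+1 ->
  padic_factorization fp alpha e g t ->
  (d%:Z%:E * (Delta + 1) < k%:Z%:E)%E ->
  padic_dvd k fp.[abar] ->
  (exists! i : 'I_n, (Delta + 1 < padic_val (abar - alpha i)%R)%E) /\
  (forall i : 'I_n, (Delta + 1 < padic_val (abar - alpha i)%R)%E ->
   forall j : 'I_n, j != i ->
   (padic_val (alpha i - alpha j)%R < padic_val (abar - alpha i)%R)%E).
Proof.
move=> fp Delta szf [[u Uu Dfp] _ e_gt0 irr nr _ t_gt0] ltk dk.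
have nzg j : g j != 0 by have [lt1g _] := irr j; rewrite -size_poly_gt0 ltnW.
have nzX i : 'X - (alpha i)%:P != 0 by rewrite polyXsubC_eq0.
have nzu : u != 0 by apply: contraTneq Uu => ->; rewrite unitr0.
have degf : (\sum_(i < n) e i + \sum_(j < m) t j * (size (g j)).-1 <= d)%N.
  suff <- : (size fp).-1 = (\sum_(i < n) e i + \sum_(j < m) t j * (size (g j)).-1)%N.
    by have := size_poly (size f) (fun i => intr f`_i : padic_int pr_p);
      rewrite -/(map_poly _ f) -/fp szf; case: (size fp).
  rewrite Dfp size_scale // degM; try by apply/prodf_neq0=> i _; rewrite expf_neq0.
  rewrite !deg_prod => [|i|i]; rewrite ?expf_neq0 //.
  congr (_ + _)%N; apply: eq_bigr => i _; rewrite size_exp ?size_XsubC ?mul1n //.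
  exact: mulnC.
have degR : ((size (padic_rad alpha g)).-1 <= d)%N.
  rewrite deg_rad // (leq_trans _ degf) // leq_add //.
    by rewrite -[X in (X <= _)%N]card_ord -sum1_card leq_sum.
  by apply: leq_sum => j _; rewrite leq_pmull.
have [D DD DP] := padic_DeltaP alpha nzg; rewrite -/Delta in DD.
have [N vD] : exists N : nat, padic_val D = N%:Z%:E.
  (* If D = 0 then Delta = +oo and the bound on k fails, because d > 0: in
     degree at most 1 the discriminant is 1. *)
  have [D0|] := eqVneq D 0; last exact: padic_val_finite.
  move: ltk; rewrite DD; have -> : padic_val D = +oo%E by apply/padic_val_eqy.
  have d_gt0 : (0 < d)%N.
    rewrite lt0n; apply/eqP=> d0; have le_R2 : (size (padic_rad alpha g) <= 2)%N.
      by move: degR; rewrite d0; lia.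
    by move: DP; rewrite le_R2 D0 => /esym/eqP; rewrite oner_eq0.
  by rewrite addye // gt0_muley ?lte_fin ?ltz_nat // ltNge leey.
have DN1 : (Delta + 1)%E = N.+1%:Z%:E by rewrite DD vD -EFinD -PoszD addn1.
have sizeR (i j : 'I_n) : j != i -> (2 < size (padic_rad alpha g))%N.
  move=> ne_ji; suff : (1 < n)%N by move: (deg_rad alpha nzg); lia.
  have := ltn_ord i; have := ltn_ord j; move: ne_ji; rewrite -(inj_eq val_inj) /=; lia.
have sepP (i j : 'I_n) : j != i -> ~ padic_dvd N.+1 (alpha i - alpha j).
  move=> ne_ji; move: DP; rewrite leqNgt (sizeR i j) //= => -[A [B DE]].
  exact: (root_separation DE vD).
have farP i : (Delta + 1 < padic_val (abar - alpha i)%R)%E <->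
    padic_dvd N.+2 (abar - alpha i).
  rewrite DN1 ltNge; split=> [/negP/padic_val_leP/contrapT|dv] //.
  by apply/negP=> /padic_val_leP.
have gP j : (padic_val (g j).[abar] <= ((size (g j)).-1 * N.+1)%N%:Z%:E)%E.
  have [lt1|le1] := ltnP 1 (size (g j)).-1; last first.
    have sz2 : size (g j) = 2%N.
      have [lt1g _] := irr j; apply/anti_leq; rewrite lt1g andbT.
      by rewrite -subn1 leq_subLR in le1.
    apply: (@le_trans _ _ (0%N%:Z%:E : \bar int)).
      by apply/padic_val_leP; apply: linear_noroot_val.
    by rewrite lee_fin lez_nat.
  have sR : (2 < size (padic_rad alpha g))%N.
    by rewrite -ltn_predRL deg_rad // (bigD1 j) //= addnCA ltn_addr.
  move: DP; rewrite leqNgt sR => -[A [B DE]]; apply/padic_val_leP => dv.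
  apply: (noroot_factor_val DE vD (j := j) (b := abar)) => //.
  by apply: padic_dvdW dv; nia.
(* Otherwise every factor of f(abar) has valuation at most its degree times
   N + 1. *)
have ex_i : exists i, padic_dvd N.+2 (abar - alpha i).
  apply: contrapT => /forallNP nfar.
  have lt_dk : (d * N.+1 < k)%N.
    by move: ltk; rewrite DN1 -EFinM lte_fin -PoszM ltz_nat.
  suff /padic_val_leP[] : (padic_val fp.[abar] <= (d * N.+1)%N%:Z%:E)%E.
    exact: padic_dvdW dk.
  have le_deg := leq_mul degf (leqnn N.+1).
  apply: (@le_trans _ _ ((\sum_(i < n) e i * N.+1 +
     \sum_(j < m) t j * ((size (g j)).-1 * N.+1))%N%:Z%:E)); last first.
    rewrite lee_fin lez_nat (leq_trans _ le_deg) // mulnDl !big_distrl /=.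
    by rewrite leq_add2l; apply: leq_sum => j _; rewrite mulnA.
  rewrite Dfp hornerZ hornerM !horner_prod -[X in X%:Z]add0n.
  apply: padic_val_leM; first by rewrite padic_val_unit.
  apply: padic_val_leM; apply: padic_val_le_prod => i; rewrite horner_exp.
    apply: padic_val_leX; apply/padic_val_leP; rewrite hornerXsubC; exact: nfar.
  exact: padic_val_leX.
split.
  have [i di] := ex_i; exists i; split=> [|j /farP dj]; first exact/farP.
  apply/eqP; apply: contrapT => /negP ne_ij; rewrite eq_sym in ne_ij.
  apply: (sepP i j ne_ij).
  have -> : alpha i - alpha j = (abar - alpha j) - (abar - alpha i) by ring.
  by apply: padic_dvdB; apply: padic_dvdW (_ : padic_dvd N.+2 _).
move=> i lt_i j ne_ji; apply: lt_trans lt_i.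
rewrite DN1 (@le_lt_trans _ _ N%:Z%:E) ?lte_fin ?ltz_nat //.
exact/padic_val_leP/sepP.
Qed.
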